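(* Let $|\psi_{id}\rangle\in\mathbb{C}^d$ be a unit vector and let $\rho$ be a density matrix on $\mathbb{C}^d$ with eigenvalues $\lambda>\lambda_2\ge\lambda_3\ge\dots\ge\lambda_d\ge0$ and corresponding orthonormal eigenvectors $|\psi\rangle,|\psi_2\rangle,\dots,|\psi_d\rangle$. Let $c=1-|\langle\psi_{id}|\psi\rangle|^2$, let $\sigma\ge 0$ be given by $\sigma^2=\langle\psi_{id}|\rho^2|\psi_{id}\rangle-\langle\psi_{id}|\rho|\psi_{id}\rangle^2$, and define $\Delta=\sigma_r/(1-Q)$, which depends only on two parameters: the relative commutator norm $\sigma_r=\sigma/\lambda$ and the ratio $Q=\lambda_2/\lambda$ of the two dominant eigenvalues. Let $\Delta\le 1/2$. Then the coherent mismatch satisfies $$c\le\frac{1-\sqrt{1-4\Delta^2}}{2}=\Delta^2+\Delta^4+\mathcal{O}(\Delta^6),$$ and for any fixed $\Delta$ there exist an infinite number of worst-case states $\rho$ that saturate this upper bound. These extremal states $\rho$ have eigenvectors $|\psi_k\rangle$ that are orthogonal to the ideal state $|\psi_{id}\rangle$, except for the two dominant eigenvectors $|\psi\rangle,|\psi_2\rangle$ that correspond to the two dominant eigenvalues $\lambda,\lambda_2$.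
   Context: A density matrix is a positive semidefinite complex matrix of trace one. The quantity $c$ is called the coherent mismatch; it is the infidelity between the dominant eigenvector $|\psi\rangle$ of $\rho$ and the ideal state $|\psi_{id}\rangle$. With $\rho_{id}=|\psi_{id}\rangle\langle\psi_{id}|$, the number $\sigma$ equals the operator norm of the commutator $[\rho_{id},\rho]$ (the commutator norm).
   Formalization: The inequality is proved under the added assumption c ≤ 1/2 (without it, d=2 and ψ_id=ψ_2 give Δ=0 but c=1); if λ_2 is degenerate, the orthogonality of ψ_k, k≥3, to ψ_id holds for a suitable choice of eigenvectors in the λ_2-eigenspace. *)

(* Defs.v *)
From HB Require Import structures.
From mathcomp Require Import all_boot all_order all_algebra.
From mathcomp Require Import complex.
From mathcomp Require Import all_classical all_reals all_analysis.
Set Implicit Arguments.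
Unset Strict Implicit.
Unset Printing Implicit Defensive.
Import Order.TTheory GRing.Theory Num.Theory numFieldNormedType.Exports.
Local Open Scope ring_scope.
Local Open Scope complex_scope.
Local Open Scope sesquilinear_scope.

Definition braket (R : realType) (d : nat) (u v : 'cV[R[i]]_d) : R[i] :=
  (u ^t* *m v) ord0 ord0.

(* In [R[i]], [0 <= z] means that [z] is real and nonnegative. *)
Definition density_matrix (R : realType) (d : nat) (rho : 'M[R[i]]_d) : Prop :=
  [/\ rho ^t* = rho,
      forall v : 'cV[R[i]]_d, 0 <= braket v (rho *m v)
    & \tr rho = 1].

(* The dimension is [n.+2] because two dominant eigenvalues are needed; indices
   start at 0, so [lam ord0], [psi ord0] are the dominant eigenvalue and
   eigenvector and [ord_second n] indexes the second ones. *)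
Definition ord_second (n : nat) : 'I_n.+2 := lift ord0 ord0.

Definition eigensystem (R : realType) (n : nat) (rho : 'M[R[i]]_n.+2)
    (lam : 'I_n.+2 -> R) (psi : 'I_n.+2 -> 'cV[R[i]]_n.+2) : Prop :=
  [/\ forall j k, braket (psi j) (psi k) = (j == k)%:R,
      forall k, rho *m psi k = (lam k)%:C *: psi k,
      lam (ord_second n) < lam ord0,
      forall j k : 'I_n.+2, (j <= k)%N -> lam k <= lam j
    & forall k, 0 <= lam k].

Definition mismatch (R : realType) (d : nat) (psid psi1 : 'cV[R[i]]_d) : R :=
  1 - Normc.normc (braket psid psi1) ^+ 2.

(* For a unit vector [psid] and a Hermitian [rho] both expectation values are
   real, and the radicand is nonnegative by the Cauchy-Schwarz inequality. *)
Definition sigma (R : realType) (d : nat) (psid : 'cV[R[i]]_d)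
    (rho : 'M[R[i]]_d) : R :=
  Num.sqrt (complex.Re (braket psid (rho *m rho *m psid)
                        - braket psid (rho *m psid) ^+ 2)).

Definition Delta_of (R : realType) (sigma_r Q : R) : R := sigma_r / (1 - Q).

Definition Delta (R : realType) (n : nat) (psid : 'cV[R[i]]_n.+2)
    (rho : 'M[R[i]]_n.+2) (lam : 'I_n.+2 -> R) : R :=
  Delta_of (sigma psid rho / lam ord0) (lam (ord_second n) / lam ord0).

Definition mismatch_bound (R : realType) (x : R) : R :=
  (1 - Num.sqrt (1 - 4 * x ^+ 2)) / 2.

Definition worst_case (R : realType) (n : nat) (psid : 'cV[R[i]]_n.+2)
    (delta : R) (rho : 'M[R[i]]_n.+2) (lam : 'I_n.+2 -> R)
    (psi : 'I_n.+2 -> 'cV[R[i]]_n.+2) : Prop :=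
  [/\ density_matrix rho, eigensystem rho lam psi, Delta psid rho lam = delta
    & mismatch psid (psi ord0) = mismatch_bound delta].

(* Main.v *)
(* Weight the eigenvalue [lam k] by [p k = |<psi k, psid>|^2]; then [sigma^2] is
   the variance of [lam]. Replacing every non-dominant eigenvalue by [lam_2]
   gives a two-point variable of variance [c (1 - c) (lam - lam_2)^2], and by
   [variance_decomp] the remainder is a sum of nonnegative terms. Hence
   [c (1 - c) <= Delta^2], which is the bound when [c <= 1 / 2]; equality forces
   [p k = 0] whenever [lam k < lam_2]. *)
Require Import Defs.
From HB Require Import structures.
From mathcomp Require Import all_boot all_order all_algebra.
From mathcomp Require Import complex.
From mathcomp Require Import all_classical all_reals all_analysis.
From mathcomp Require Import ring lra.
Set Implicit Arguments.
Unset Strict Implicit.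
Unset Printing Implicit Defensive.
Import Order.TTheory GRing.Theory Num.Theory numFieldNormedType.Exports.
Local Open Scope classical_set_scope.
Local Open Scope ring_scope.

Local Open Scope sesquilinear_scope.

(** * Sesquilinear algebra of the inner product *)

Lemma braketE (R : realType) d (u v : 'cV[R[i]]_d) :
  braket u v = \sum_i (u i ord0)^* * v i ord0.
Proof. by rewrite /braket mxE; apply: eq_bigr => i _; rewrite !mxE. Qed.

Lemma braketC (R : realType) d (u v : 'cV[R[i]]_d) :
  braket v u = (braket u v)^*.
Proof.
rewrite !braketE rmorph_sum; apply: eq_bigr => i _.
by rewrite rmorphM /= conjCK mulrC.
Qed.

Lemma braketDr (R : realType) d (u v w : 'cV[R[i]]_d) :
  braket u (v + w) = braket u v + braket u w.
Proof. by rewrite /braket mulmxDr mxE. Qed.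

Lemma braketZr (R : realType) d (u v : 'cV[R[i]]_d) a :
  braket u (a *: v) = a * braket u v.
Proof. by rewrite /braket -scalemxAr mxE. Qed.

Lemma braketBr (R : realType) d (u v w : 'cV[R[i]]_d) :
  braket u (v - w) = braket u v - braket u w.
Proof. by rewrite -scaleN1r braketDr braketZr mulN1r. Qed.

Lemma braket_sumr (R : realType) d (I : finType) (u : 'cV[R[i]]_d)
    (v : I -> 'cV[R[i]]_d) :
  braket u (\sum_k v k) = \sum_k braket u (v k).
Proof. by rewrite /braket mulmx_sumr summxE. Qed.

Lemma braketDl (R : realType) d (u v w : 'cV[R[i]]_d) :
  braket (v + w) u = braket v u + braket w u.
Proof. by rewrite braketC braketDr rmorphD /= -!braketC. Qed.

Lemma braketZl (R : realType) d (u v : 'cV[R[i]]_d) a :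
  braket (a *: v) u = a^* * braket v u.
Proof. by rewrite braketC braketZr rmorphM /= -!braketC. Qed.

Lemma braketBl (R : realType) d (u v w : 'cV[R[i]]_d) :
  braket (v - w) u = braket v u - braket w u.
Proof. by rewrite braketC braketBr rmorphB /= -!braketC. Qed.

Lemma braket_conjM (R : realType) d (u v : 'cV[R[i]]_d) :
  (braket u v)^* * braket u v = (Normc.normc (braket u v) ^+ 2)%:C%C.
Proof. by rewrite -normCKC rmorphXn. Qed.

Lemma normc_braketC (R : realType) d (u v : 'cV[R[i]]_d) :
  Normc.normc (braket u v) = Normc.normc (braket v u).
Proof. by apply: complexI; rewrite (braketC u v); exact: esym (norm_conjC _). Qed.

Lemma braket0_eq0 (R : realType) d (u : 'cV[R[i]]_d) : braket u u = 0 -> u = 0.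
Proof.
rewrite braketE => /eqP; rewrite psumr_eq0; last first.
  by move=> i _; rewrite -normCKC exprn_ge0.
move=> /allP h; apply/matrixP => i j; rewrite (ord1 j) mxE; apply/eqP.
by have := h i (mem_index_enum i); rewrite -normCKC expf_eq0 normr_eq0.
Qed.

(** * Orthonormal bases: expansion, Parseval, replacing a basis vector *)

Definition orthonormal_basis (R : realType) d (psi : 'I_d -> 'cV[R[i]]_d) :=
  forall j k, braket (psi j) (psi k) = (j == k)%:R.

(** The matrix with columns [psi k] has a left inverse, its adjoint; being square, it has the same
    right inverse, and this completeness relation is applied to [v]. *)
Lemma basis_expand (R : realType) d (psi : 'I_d -> 'cV[R[i]]_d) v :
  orthonormal_basis psi -> v = \sum_k braket (psi k) v *: psi k.
Proof.
move=> hpsi; pose P := \matrix_(i, k) psi k i ord0.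
have PP : P ^t* *m P = 1%:M.
  apply/matrixP => j k; rewrite mxE [RHS]mxE -hpsi braketE.
  by apply: eq_bigr => i _; rewrite !mxE.
rewrite -[LHS]mul1mx -(mulmx1C PP) -mulmxA.
apply/matrixP => i j; rewrite (ord1 j) mxE summxE; apply: eq_bigr => k _.
rewrite !mxE mulrC; congr (_ * _); rewrite braketE.
by apply: eq_bigr => l _; rewrite !mxE.
Qed.

Lemma parseval (R : realType) d (psi : 'I_d -> 'cV[R[i]]_d) u v :
  orthonormal_basis psi ->
  braket u v = \sum_k (braket (psi k) u)^* * braket (psi k) v.
Proof.
move=> hpsi; rewrite {1}(basis_expand v hpsi) braket_sumr.
by apply: eq_bigr => k _; rewrite braketZr mulrC -braketC.
Qed.

(** An operator diagonal in the basis [psi] has as its expectation in [u] the [p]-weighted sum of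
    its eigenvalues; this is used for [rho] and for its square, both diagonal in [psi]. *)
Lemma eigen_variance (R : realType) d (rho : 'M[R[i]]_d) (lam : 'I_d -> R)
    (psi : 'I_d -> 'cV[R[i]]_d) (u : 'cV[R[i]]_d)
    (p := fun k => Normc.normc (braket (psi k) u) ^+ 2) :
  orthonormal_basis psi -> (forall k, rho *m psi k = (lam k)%:C%C *: psi k) ->
  complex.Re (braket u (rho *m rho *m u) - braket u (rho *m u) ^+ 2) =
  \sum_k p k * lam k ^+ 2 - (\sum_k p k * lam k) ^+ 2.
Proof.
move=> hpsi hrho.
have hB (A : 'M[R[i]]_d) (mu : 'I_d -> R) :
    (forall k, A *m psi k = (mu k)%:C%C *: psi k) ->
    braket u (A *m u) = (\sum_k p k * mu k)%:C%C.
  move=> hA; rewrite {2}(basis_expand u hpsi) mulmx_sumr braket_sumr.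
  rewrite rmorph_sum /=.
  apply: eq_bigr => k _; rewrite -scalemxAr hA !braketZr rmorphM /= -braket_conjM.
  by rewrite -braketC mulrCA mulrC [braket (psi k) u * _]mulrC.
have hrho2 k : rho *m rho *m psi k = (lam k ^+ 2)%:C%C *: psi k.
  by rewrite -mulmxA hrho -scalemxAr hrho scalerA rmorphXn.
by rewrite (hB _ _ hrho) (hB _ _ hrho2) -rmorphXn -rmorphB.
Qed.

Lemma sum_weights (R : realType) d (psi : 'I_d -> 'cV[R[i]]_d) u :
  orthonormal_basis psi -> braket u u = 1 ->
  \sum_k Normc.normc (braket (psi k) u) ^+ 2 = 1.
Proof.
move=> hpsi; rewrite (parseval u u hpsi) => h; apply: complexI.
rewrite -[RHS]h rmorph_sum; apply: eq_bigr => k _.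
by rewrite braket_conjM.
Qed.

(* The reflection-like map [w |-> w - <v, w> / <v, psi j> v] with
   [v = psi j - u] is unitary and sends [psi j] to [u], without any phase
   adjustment; if [<v, psi j> = 0] then [v = 0] and, since [0^-1 = 0], the map
   is the identity. *)
Lemma orthonormal_basis_replace (R : realType) d (psi : 'I_d -> 'cV[R[i]]_d)
    (u : 'cV[R[i]]_d) (j : 'I_d) :
  orthonormal_basis psi -> braket u u = 1 ->
  exists psi' : 'I_d -> 'cV[R[i]]_d,
    [/\ orthonormal_basis psi', psi' j = u,
        forall k, exists a, psi' k = psi k + a *: (psi j - u)
      & forall k, k != j -> braket u (psi k) = 0 -> psi' k = psi k].
Proof.
move=> hpsi hu; pose v := psi j - u; pose s := braket v (psi j).
(* Both [psi j] and [u] are unit vectors, so [s = 1 - <u, psi j>] has twice its real part equal to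
   [<v, v>]. This identity is what makes the map unitary. *)
have hvv : braket v v = s + s^*.
  rewrite /s -braketC /v !braketBl !braketBr hpsi eqxx hu.
  by rewrite /=; ring.
have hv0 : s = 0 -> v = 0.
  by move=> s0; apply: braket0_eq0; rewrite hvv s0 conjC0 addr0.
exists (fun k => psi k - (braket v (psi k) / s) *: v); split.
- move=> k l; rewrite braketBl !braketBr !braketZr !braketZl hvv hpsi.
  rewrite (braketC v (psi k)) rmorphM fmorphV /=.
  have [s0|s0] := eqVneq s 0.
    rewrite s0 conjC0 invr0; by ring.
  have s0' : s^* != 0 by rewrite conjC_eq0.
  (* The inner product of two images, with [x], [y] standing for [s] and its conjugate and [x + y]
     for [<v, v>]; as independent elements of a field they are within reach of [field]. *)
  have unitary (F : fieldType) (x y z t e : F) : x != 0 -> y != 0 ->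
      e - z / x * t - (t / y * z - z / x * (t / y * (x + y))) = e
    by move=> *; field; apply/andP.
  exact: unitary.
- have [s0|s0] := eqVneq s 0.
    by have := hv0 s0; rewrite /v => /eqP; rewrite subr_eq0 => /eqP ->;
       rewrite subrr scaler0 subr0.
  by rewrite divff // scale1r /v opprB addrC subrK.
- by move=> k; exists (- (braket v (psi k) / s)); rewrite scaleNr.
- move=> k kj uk; rewrite {1}/v braketBl hpsi eq_sym (negbTE kj) uk.
  by rewrite subrr mul0r scale0r subr0.
Qed.

(** * Variance of a weighted family of reals, split around one index *)

Lemma sum_pred1_weight (R : realType) (I : finType) (p : I -> R) i0 :
  \sum_k p k * (k != i0)%:R = \sum_k p k - p i0.
Proof.
rewrite (bigD1 i0) //= eqxx mulr0 add0r [X in _ = X - _](bigD1 i0) //=.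
rewrite [X in X - _]addrC addrK.
by apply: eq_bigr => k ->; rewrite mulr1.
Qed.

(** Write [lam k = lam i0 - (g * [k != i0] + Z k)]. The indicator has variance [c * (1 - c)]; as [Z]
    vanishes at [i0], its covariance with the indicator is [z - c * z = (1 - c) * z]. The last sum
    is the variance of [Z]. *)
Lemma variance_decomp (R : realType) (I : finType) (p lam : I -> R) (i0 : I)
    (l : R) (c := 1 - p i0) (g := lam i0 - l)
    (Z := fun k => (k != i0)%:R * (l - lam k)) (z := \sum_k p k * Z k) :
  \sum_k p k = 1 ->
  \sum_k p k * lam k ^+ 2 - (\sum_k p k * lam k) ^+ 2 =
  c * (1 - c) * g ^+ 2 + (2 * g * (1 - c) * z + \sum_k p k * (Z k - z) ^+ 2).
Proof.
move=> p1.
have pc : \sum_k p k * (k != i0)%:R = c by rewrite sum_pred1_weight p1.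
have -> : \sum_k p k * lam k ^+ 2 =
    lam i0 ^+ 2 * (\sum_k p k)
    + (g ^+ 2 - 2 * lam i0 * g) * (\sum_k p k * (k != i0)%:R)
    + (2 * g - 2 * lam i0) * (\sum_k p k * Z k) + \sum_k p k * Z k ^+ 2.
  rewrite !mulr_sumr -!big_split /=; apply: eq_bigr => k _.
  by rewrite /Z /g; case: eqVneq => [->|_] /=; ring.
have -> : \sum_k p k * lam k =
    lam i0 * (\sum_k p k) - g * (\sum_k p k * (k != i0)%:R)
    - \sum_k p k * Z k.
  rewrite !mulr_sumr -!sumrB; apply: eq_bigr => k _.
  by rewrite /Z /g; case: eqVneq => [->|_] /=; ring.
have -> y : \sum_k p k * (Z k - y) ^+ 2 =
    \sum_k p k * Z k ^+ 2 - 2 * y * (\sum_k p k * Z k)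
    + y ^+ 2 * (\sum_k p k).
  by rewrite !mulr_sumr -sumrB -big_split /=; apply: eq_bigr => k _; ring.
by rewrite -/z pc p1; ring.
Qed.

(** * The scalar bound and its expansion at zero *)

Lemma DeltaE (R : realType) n (psid : 'cV[R[i]]_n.+2) rho lam psi :
  eigensystem rho lam psi ->
  Delta psid rho lam = sigma psid rho / (lam ord0 - lam (ord_second n)).
Proof.
case=> _ _ h12 _ h0; have := h0 (ord_second n) => h2.
rewrite /Delta /Delta_of; field.
by apply/andP; split; [lra | apply/eqP; lra].
Qed.

(** Since [(1 - 2 * c) ^+ 2 = 1 - 4 * (c * (1 - c))], the second hypothesis compares this square
    with the radicand; [c <= 1 / 2] makes [1 - 2 * c] its nonnegative root. Where the radicand is
    negative, [Num.sqrt] is 0 and the bound is [1 / 2]. *)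
Lemma mismatch_bound_le (R : realType) (c x : R) :
  c <= 1 / 2 -> c * (1 - c) <= x ^+ 2 -> c <= mismatch_bound x.
Proof.
move=> hc h; rewrite /mismatch_bound.
have : Num.sqrt (1 - 4 * x ^+ 2) <= 1 - 2 * c; last by lra.
have -> : 1 - 2 * c = Num.sqrt ((1 - 2 * c) ^+ 2).
  by rewrite sqrtr_sqr ger0_norm; lra.
by apply: ler_wsqrtr; nra.
Qed.

Lemma mismatch_bound_root (R : realType) (x : R) :
  4 * x ^+ 2 <= 1 ->
  mismatch_bound x * (1 - mismatch_bound x) = x ^+ 2.
Proof.
move=> h; rewrite /mismatch_bound.
have : Num.sqrt (1 - 4 * x ^+ 2) ^+ 2 = 1 - 4 * x ^+ 2 by rewrite sqr_sqrtr; lra.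
move: (Num.sqrt _) => s hs.
have -> : x ^+ 2 = (1 - s ^+ 2) / 4 by rewrite hs; field.
by field.
Qed.

Lemma mismatch_bound_itv (R : realType) (x : R) :
  0 <= mismatch_bound x <= 1 / 2.
Proof.
rewrite /mismatch_bound; have h0 := sqrtr_ge0 (1 - 4 * x ^+ 2).
have : Num.sqrt (1 - 4 * x ^+ 2) <= 1.
  rewrite -[X in _ <= X]sqrtr1; apply: ler_wsqrtr.
  by have := sqr_ge0 x; lra.
by move=> h1; apply/andP; split; lra.
Qed.

(** The quadratic equation replaces a Taylor series: with [y = x ^+ 2], the bound [b] satisfies
    [b - b ^+ 2 = y], from which the remainder is computed exactly. *)
Lemma mismatch_bound_expansion (R : realType) :
  (fun x : R => mismatch_bound x) =
    (fun x : R => x ^+ 2 + x ^+ 4) +O_ (nbhs (0 : R)) (fun x : R => x ^+ 6).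
Proof.
apply/eqaddOP/bigO_exP; exists 12 => //; near=> x.
change (`|mismatch_bound x - (x ^+ 2 + x ^+ 4)| <= 12 * `|x ^+ 6|).
have hx : `|x| <= 1 / 2.
  by near: x; apply: (@nbhs0_le R R); lra.
have h4 : 4 * x ^+ 2 <= 1.
  by rewrite -real_normK ?num_real//; have := normr_ge0 x; nra.
have hr := mismatch_bound_root h4; have /andP[b0 b1] := mismatch_bound_itv x.
have y0 := sqr_ge0 x.
have -> : (x ^+ 6) = (x ^+ 2) ^+ 3 by rewrite -exprM.
have e4 : (x ^+ 4) = (x ^+ 2) ^+ 2 by rewrite -exprM.
rewrite e4; move: (mismatch_bound x) (x ^+ 2) hr b0 b1 y0 h4.
move=> b y hr b0 b1 y0 h4.
(* From [b * (1 - b) = y] and [1 - b >= 1 / 2]. The remainder [b ^+ 2 - y ^+ 2 = (b - y) * (b + y)]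
   equals [b ^+ 2 * (b + y)], at most [4 y ^+ 2] times [3 y]; hence the constant 12. *)
have by2 : b <= 2 * y by nra.
have -> : b - (y + y ^+ 2) = b ^+ 2 * (b + y) by rewrite -hr; ring.
rewrite !ger0_norm ?mulr_ge0 ?exprn_ge0 ?addr_ge0//.
have : b ^+ 2 <= 4 * y ^+ 2 by nra.
have : 0 <= y ^+ 2 by exact: sqr_ge0.
have -> : y ^+ 3 = y ^+ 2 * y by rewrite exprS mulrC.
have : 0 <= b ^+ 2 by exact: sqr_ge0.
move: (b ^+ 2) (y ^+ 2) => B Y; nra.
Unshelve. all: by end_near.
Qed.

(** * The upper bound on the mismatch *)

Lemma mismatch_ge0 (R : realType) d (psi : 'I_d -> 'cV[R[i]]_d) psid k :
  orthonormal_basis psi -> braket psid psid = 1 -> 0 <= mismatch psid (psi k).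
Proof.
move=> hpsi hpsid; rewrite /mismatch normc_braketC subr_ge0.
rewrite -(sum_weights hpsi hpsid) (bigD1 k) //= lerDl.
by apply: sumr_ge0 => l _; exact: sqr_ge0.
Qed.

Lemma eigen_gap_gt0 (R : realType) n (rho : 'M[R[i]]_n.+2) lam psi :
  eigensystem rho lam psi -> 0 < lam ord0 - lam (ord_second n).
Proof. by case=> _ _ h _ _; rewrite subr_gt0. Qed.

Lemma lam_le_second (R : realType) n (rho : 'M[R[i]]_n.+2) lam psi k :
  eigensystem rho lam psi -> k != ord0 -> lam k <= lam (ord_second n).
Proof. by case=> _ _ _ h _ k0; apply: h; rewrite lt0n. Qed.

(** The variance decomposition around the dominant index with [l = lam_2]. The sign of [z] makes the
    remainder nonnegative, which serves both the bound and the analysis of equality. *)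
Lemma sigma_sqr (R : realType) n (psid : 'cV[R[i]]_n.+2) rho lam psi
    (p := fun k => Normc.normc (braket (psi k) psid) ^+ 2)
    (c := mismatch psid (psi ord0)) (g := lam ord0 - lam (ord_second n))
    (Z := fun k => (k != ord0)%:R * (lam (ord_second n) - lam k))
    (z := \sum_k p k * Z k) :
  braket psid psid = 1 -> eigensystem rho lam psi ->
  sigma psid rho ^+ 2 =
    c * (1 - c) * g ^+ 2
    + (2 * g * (1 - c) * z + \sum_k p k * (Z k - z) ^+ 2)
  /\ 0 <= z.
Proof.
move=> hpsid hes; have [hpsi hrho _ _ _] := hes.
have cE : 1 - p ord0 = c by rewrite /p /c /mismatch normc_braketC.
have p0 k : 0 <= p k by exact: sqr_ge0.
have z0 : 0 <= z.
  apply: sumr_ge0 => k _; apply: mulr_ge0 => //; rewrite /Z.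
  case: eqVneq => [->|k0] /=; first by rewrite mul0r.
  by rewrite mul1r subr_ge0; exact: lam_le_second hes k0.
split=> //; rewrite /sigma (eigen_variance psid hpsi hrho).
rewrite (@variance_decomp _ _ p lam ord0 (lam (ord_second n))); last first.
  exact: sum_weights hpsi hpsid.
rewrite cE sqr_sqrtr.
  by [].
(* To undo the square root the radicand must be nonnegative; this is read off term by term from the
   decomposition. *)
have c0 : 0 <= c := mismatch_ge0 ord0 hpsi hpsid.
have c1 : 0 <= 1 - c by rewrite -cE; have := p0 ord0; lra.
have g0 := ltW (eigen_gap_gt0 hes).
apply: addr_ge0; first by rewrite !mulr_ge0 // sqr_ge0.
apply: addr_ge0; first by rewrite !mulr_ge0.
by apply: sumr_ge0 => k _; rewrite mulr_ge0 ?sqr_ge0.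
Qed.

(** Dropping the remainder leaves [c * (1 - c) <= Delta ^+ 2], which also admits values of [c] near
    1; the hypothesis [c <= 1 / 2] selects the lower branch. *)
Lemma mismatch_upper_bound (R : realType) n (psid : 'cV[R[i]]_n.+2) rho lam psi :
  braket psid psid = 1 -> eigensystem rho lam psi ->
  mismatch psid (psi ord0) <= 1 / 2 ->
  mismatch psid (psi ord0) <= mismatch_bound (Delta psid rho lam).
Proof.
move=> hpsid hes hc; apply: mismatch_bound_le => //.
have g0 := eigen_gap_gt0 hes.
rewrite (DeltaE _ hes) expr_div_n ler_pdivlMr ?exprn_gt0 //.
have [-> z0] := sigma_sqr hpsid hes; rewrite lerDl.
apply: addr_ge0; first by rewrite !mulr_ge0 //; lra.
by apply: sumr_ge0 => k _; rewrite mulr_ge0 ?sqr_ge0.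
Qed.

Lemma Delta_ge0 (R : realType) n (psid : 'cV[R[i]]_n.+2) rho lam psi :
  eigensystem rho lam psi -> 0 <= Delta psid rho lam.
Proof.
by move=> hes; rewrite (DeltaE _ hes) divr_ge0 ?sqrtr_ge0 ?ltW ?(eigen_gap_gt0 hes).
Qed.

(** * Structure of the states that attain the bound *)

Lemma worst_case_mismatch (R : realType) n (psid : 'cV[R[i]]_n.+2) delta rho
    lam psi (c := mismatch psid (psi ord0)) :
  delta <= 1 / 2 -> worst_case psid delta rho lam psi ->
  c <= 1 / 2 /\ c * (1 - c) = delta ^+ 2.
Proof.
move=> hd [_ hes hD hm]; rewrite /c hm.
(* Nonnegativity of [delta] turns [delta <= 1 / 2] into [4 * delta ^+ 2 <= 1], so the quadratic
   equation has real roots. *)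
have := Delta_ge0 psid hes; rewrite hD => d0.
rewrite mismatch_bound_root; last by nra.
by have /andP[] := mismatch_bound_itv delta.
Qed.

(** Equality kills the remainder, a sum of two nonnegative terms. Its first term has positive
    factors [g] and [1 - c], so [z = 0]; every summand of [z] is nonnegative, so each one
    vanishes. *)
Lemma worst_case_support (R : realType) n (psid : 'cV[R[i]]_n.+2) delta rho
    lam psi k :
  braket psid psid = 1 -> delta <= 1 / 2 -> worst_case psid delta rho lam psi ->
  k != ord0 -> lam k != lam (ord_second n) -> braket (psi k) psid = 0.
Proof.
move=> hpsid hd hw k0 kl; have [hc ceq] := worst_case_mismatch hd hw.
have [_ hes hD _] := hw; have g0 := eigen_gap_gt0 hes.
pose Z := fun k => (k != ord0)%:R * (lam (ord_second n) - lam k).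
pose z := \sum_k Normc.normc (braket (psi k) psid) ^+ 2 * Z k.
pose S := \sum_k Normc.normc (braket (psi k) psid) ^+ 2 * (Z k - z) ^+ 2.
have [] := sigma_sqr hpsid hes; rewrite -/Z -/z -/S ceq.
have -> : sigma psid rho ^+ 2 = delta ^+ 2 * (lam ord0 - lam (ord_second n)) ^+ 2.
  by rewrite -hD (DeltaE _ hes) expr_div_n divfK // expf_neq0 // gt_eqF.
move=> hs z0.
have S0 : 0 <= S by apply: sumr_ge0 => l _; rewrite mulr_ge0 ?sqr_ge0.
have c1 : 0 < 1 - mismatch psid (psi ord0) by lra.
have A0 : 0 <= 2 * (lam ord0 - lam (ord_second n)) *
   (1 - mismatch psid (psi ord0)) * z by rewrite !mulr_ge0 //; exact: ltW.
move: hs; rewrite -[LHS]addr0 => /addrI /esym/eqP; rewrite paddr_eq0 //.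
case/andP=> + _; rewrite !mulf_eq0 pnatr_eq0 (gt_eqF g0) (gt_eqF c1) /=.
rewrite psumr_eq0; last first.
  move=> l _; apply: mulr_ge0; first exact: sqr_ge0.
  rewrite /Z; case: eqVneq => [->|l0] /=; first by rewrite mul0r.
  by rewrite mul1r subr_ge0; exact: lam_le_second hes l0.
move=> /allP /(_ k (mem_index_enum k)) /=.
rewrite /Z k0 mul1r mulf_eq0 expf_eq0 /= subr_eq0 [lam _ == _]eq_sym (negbTE kl) orbF.
by move=> /eqP; exact: Normc.eq0_normc.
Qed.

Lemma eigenvector_lincomb (R : realType) d (rho : 'M[R[i]]_d) (x y : 'cV[R[i]]_d)
    (l b : R[i]) :
  rho *m x = l *: x -> rho *m y = l *: y ->
  rho *m (x + b *: y) = l *: (x + b *: y).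
Proof.
by move=> hx hy; rewrite mulmxDr -scalemxAr hx hy scalerDr !scalerA [b * l]mulrC.
Qed.

(** When [lam_2] is degenerate, [psid] may overlap several of its eigenvectors. The component [w] of
    [psid] orthogonal to [psi ord0] lies in that eigenspace, so the basis can be rotated there until
    its second vector is [w] normalized; [psid] is then spanned by the first two vectors. *)
Lemma worst_case_eigenvectors (R : realType) n (psid : 'cV[R[i]]_n.+2) delta rho
    lam psi :
  braket psid psid = 1 -> delta <= 1 / 2 -> worst_case psid delta rho lam psi ->
  exists psi' : 'I_n.+2 -> 'cV[R[i]]_n.+2,
    [/\ eigensystem rho lam psi', psi' ord0 = psi ord0,
        forall k : 'I_n.+2, (2 <= k)%N -> braket (psi' k) psid = 0,
        braket (psi' ord0) psid != 0
      & 0 < delta -> braket (psi' (ord_second n)) psid != 0].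
Proof.
move=> hpsid hd hw; have [hc ceq] := worst_case_mismatch hd hw.
have supp k := worst_case_support (k := k) hpsid hd hw.
have [_ hes _ _] := hw; have [hpsi hrho h12 hmono hge] := hes.
set c := mismatch psid (psi ord0) in hc ceq.
pose a := braket (psi ord0) psid; pose w := psid - a *: psi ord0.
(* A vanishing overlap would give [c = 1]. *)
have a0 : a != 0.
  apply/eqP => a0; move: hc; rewrite /c /mismatch normc_braketC -/a a0.
  by rewrite Normc.normc0; lra.
have psiw k : braket (psi k) w = (k != ord0)%:R * braket (psi k) psid.
  rewrite /w braketBr braketZr hpsi; case: eqVneq => [->|_] /=.
    by rewrite mulr1 subrr mul0r.
  by rewrite mulr0 subr0 mul1r.
have ww : braket w w = c%:C%C.
  rewrite {1}/w braketBl braketZl psiw eqxx mul0r mulr0 subr0 /w braketBr braketZr.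
  rewrite hpsid (braketC (psi ord0)) -/a mulrC braket_conjM -/a.
  by rewrite /c /mismatch normc_braketC rmorphB rmorph1.
(* If [c = 0], then [psid] is a multiple of [psi ord0] and [psi] itself serves; [delta] is then 0,
   so the last claim is vacuous. *)
have [c0|c0] := eqVneq c 0.
  have w0 : w = 0 by apply: braket0_eq0; rewrite ww c0.
  exists psi; split; [exact: hes | by [] | move=> k k2 | exact: a0 | move=> d0].
    have k0 : k != ord0 by rewrite -val_eqE -lt0n (leq_trans _ k2).
    have := psiw k; rewrite w0 k0 mul1r => <-.
    by rewrite -[0 in LHS](scale0r 0) braketZr mul0r.
  exfalso; have := exprn_gt0 2 d0.
  by rewrite -ceq c0 mul0r ltxx.
have cge0 : 0 <= c := mismatch_ge0 ord0 hpsi hpsid.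
(* [r] is the norm of [w]. *)
pose r : R[i] := (Num.sqrt c)%:C%C.
have rr : r * r = c%:C%C by rewrite /r -rmorphM /= -expr2 sqr_sqrtr.
have r0 : r != 0.
  by apply/eqP => r0; move/eqP: rr; rewrite r0 mul0r eq_sym fmorph_eq0 (negbTE c0).
have rconj : r^* = r by exact: conjc_real.
pose u := r^-1 *: w.
have uu : braket u u = 1.
  by rewrite /u braketZl braketZr fmorphV /= rconj ww -rr mulrA; field.
have [psi' [hpsi' psi'1 psi'E psi'fix]] :=
  orthonormal_basis_replace (ord_second n) hpsi uu.
have upsi k : braket u (psi k) = 0 <-> (k != ord0)%:R * braket (psi k) psid = 0.
  rewrite braketC braketZr psiw; split=> [/eqP|->]; last by rewrite mulr0 conjC0.
  by rewrite conjC_eq0 mulf_eq0 invr_eq0 (negbTE r0) => /eqP.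
have psi'0 : psi' ord0 = psi ord0 by apply: psi'fix => //; apply/upsi; rewrite mul0r.
have psidE : psid = r *: psi' (ord_second n) + a *: psi' ord0.
  by rewrite psi'1 psi'0 /u scalerA divff // scale1r /w subrK.
have bE k : braket (psi' k) psid = r * (k == ord_second n)%:R + a * (k == ord0)%:R.
  by rewrite psidE braketDr !braketZr !hpsi'.
exists psi'; split; first (split; [exact: hpsi' | move=> k | exact: h12
    | exact: hmono | exact: hge]); [ | exact: psi'0 | | | ].
(* Vectors outside the [lam_2] eigenspace are orthogonal to [u] and stay fixed; the others change by
   a multiple of [psi (ord_second n) - u], which lies in that eigenspace. *)
- have [kl|kl] := eqVneq (lam k) (lam (ord_second n)); last first.
    rewrite psi'fix //; first by apply: contra kl => /eqP ->.
    apply/upsi; have [->|k0] := eqVneq k ord0; first by rewrite mul0r.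
    by rewrite (supp k k0 kl) mulr0.
  have [b ->] := psi'E k.
  (* In the expansion of [w], the coefficient at [ord0] vanishes by construction and those with
     eigenvalue other than [lam_2] by [worst_case_support]. *)
  have rhow : rho *m w = (lam (ord_second n))%:C%C *: w.
    rewrite {1 2}(basis_expand w hpsi) mulmx_sumr scaler_sumr; apply: eq_bigr => l _.
    rewrite -scalemxAr hrho psiw !scalerA.
    have [->|l0] := eqVneq l ord0; first by rewrite !(mul0r, mulr0) !scale0r.
    have [<-|ll] := eqVneq (lam l) (lam (ord_second n)); first by rewrite mulrC.
    by rewrite (supp l l0 ll) !(mul0r, mulr0) !scale0r.
  rewrite kl; apply: eigenvector_lincomb; first by rewrite hrho kl.
  rewrite -(scaleN1r u); apply: eigenvector_lincomb; first exact: hrho.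
  by rewrite -scalemxAr rhow !scalerA mulrC.
- move=> k k2; rewrite bE -!val_eqE /= !gtn_eqF ?(leq_trans _ k2) //.
  by rewrite !mulr0 addr0.
- by rewrite bE eqxx -val_eqE /= mulr0 add0r mulr1.
- by move=> _; rewrite bE eqxx -val_eqE /= mulr0 addr0 mulr1.
Qed.

(** * Construction of infinitely many worst-case states *)

Lemma delta_orthonormal_basis (R : realType) d :
  orthonormal_basis (fun k : 'I_d => delta_mx k ord0 : 'cV[R[i]]_d).
Proof.
move=> j k; rewrite braketE (bigD1 j) //= !mxE !eqxx conjC1 mul1r andbT.
rewrite big1 ?addr0 // => i ij; rewrite mxE (negbTE ij) conjC0 mul0r.
by [].
Qed.

(** The spectral sum of [lam k] times the projector onto [psi k], given entrywise. *)
Definition mix_states (R : realType) d (lam : 'I_d -> R)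
    (psi : 'I_d -> 'cV[R[i]]_d) : 'M[R[i]]_d :=
  \matrix_(i, j) \sum_k (lam k)%:C%C * (psi k i ord0 * (psi k j ord0)^*).

Lemma mix_states_mul (R : realType) d (lam : 'I_d -> R)
    (psi : 'I_d -> 'cV[R[i]]_d) v :
  mix_states lam psi *m v = \sum_k (lam k)%:C%C *: (braket (psi k) v *: psi k).
Proof.
apply/matrixP => i j; rewrite (ord1 j) mxE summxE.
under eq_bigr do rewrite mxE mulr_suml.
rewrite exchange_big /=; apply: eq_bigr => k _; rewrite !mxE braketE.
rewrite mulr_suml mulr_sumr; apply: eq_bigr => l _.
by rewrite -!mulrA; congr (_ * _); rewrite mulrC mulrA.
Qed.

Lemma mix_states_density (R : realType) d (lam : 'I_d -> R)
    (psi : 'I_d -> 'cV[R[i]]_d) :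
  orthonormal_basis psi -> (forall k, 0 <= lam k) -> \sum_k lam k = 1 ->
  density_matrix (mix_states lam psi).
Proof.
move=> hpsi h0 h1; split.
- apply/matrixP => i j; rewrite !mxE rmorph_sum; apply: eq_bigr => k _.
  rewrite !rmorphM /= conjCK [(psi k j _)^* * _]mulrC; congr (_ * _).
  exact: conjc_real.
- move=> v; rewrite mix_states_mul braket_sumr; apply: sumr_ge0 => k _.
  rewrite !braketZr (braketC (psi k) v) [X in _ * X]mulrC braket_conjM -rmorphM.
  by rewrite /= lecR mulr_ge0 ?sqr_ge0.
- rewrite /mxtrace; under eq_bigr do rewrite mxE.
  rewrite exchange_big /= -[RHS](rmorph1 (real_complex R)) -h1 rmorph_sum.
  apply: eq_bigr => k _; rewrite -mulr_sumr -[RHS]mulr1; congr (_ * _).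
  have <- : braket (psi k) (psi k) = 1 by rewrite hpsi eqxx.
  by rewrite braketE; apply: eq_bigr => i _; rewrite mulrC.
Qed.

(** Two replacements: the standard basis becomes a basis [f] starting with [psid], then [f ord0] is
    tilted towards the second vector by amplitudes [sqrt (1 - b)] and [sqrt b]. The remaining [f k]
    are orthogonal to both vectors of the tilt, hence unchanged and orthogonal to [psid]. *)
Lemma exists_tilted_basis (R : realType) n (psid : 'cV[R[i]]_n.+2) (b : R) :
  braket psid psid = 1 -> 0 <= b <= 1 ->
  exists psi : 'I_n.+2 -> 'cV[R[i]]_n.+2,
    [/\ orthonormal_basis psi, mismatch psid (psi ord0) = b
      & forall k : 'I_n.+2, (2 <= k)%N -> braket (psi k) psid = 0].
Proof.
move=> hpsid /andP[b0 b1].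
have [f [hf f0 _ _]] :=
  orthonormal_basis_replace ord0 (@delta_orthonormal_basis R n.+2) hpsid.
pose x : R[i] := (Num.sqrt (1 - b))%:C%C; pose y : R[i] := (Num.sqrt b)%:C%C.
have xc : x^* = x by exact: conjc_real.
have yc : y^* = y by exact: conjc_real.
pose u := x *: f ord0 + y *: f (ord_second n).
have fu k : braket u (f k) = x * (ord0 == k)%:R + y * (ord_second n == k)%:R.
  by rewrite braketDl !braketZl !hf xc yc.
have uu : braket u u = 1.
  rewrite {2}/u braketDr !braketZr !fu !eqxx /= !mulr0 !mulr1 addr0 add0r.
  rewrite -!rmorphM -rmorphD /= -!expr2 !sqr_sqrtr ?subr_ge0 // subrK.
  by rewrite rmorph1.
have [psi [hpsi psi0 _ psifix]] := orthonormal_basis_replace ord0 hf uu.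
exists psi; split=> //.
  have uf0 : braket u (f ord0) = x by rewrite fu eqxx /= mulr1 mulr0 addr0.
  rewrite /mismatch psi0 normc_braketC -f0 uf0.
  have -> : Normc.normc x ^+ 2 = 1 - b.
    by rewrite /= expr0n addr0 sqrtr_sqr ger0_norm ?sqrtr_ge0 // sqr_sqrtr ?subr_ge0.
  by rewrite opprB addrC subrK.
move=> k k2; have k0 : k != ord0 by rewrite -val_eqE -lt0n (leq_trans _ k2).
have k1 : k != ord_second n by rewrite -val_eqE /= gtn_eqF.
rewrite psifix //; first by rewrite -f0 hf (negbTE k0).
by rewrite fu ![_ == k]eq_sym (negbTE k0) (negbTE k1) !mulr0 addr0.
Qed.

(** A spectrum of sum one; [1 / 2 < t <= 1] makes [t] strictly dominant and keeps all values
    nonnegative. *)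
Definition two_level (R : realType) n (t : R) (k : 'I_n.+2) : R :=
  if k == ord0 then t else if k == ord_second n then 1 - t else 0.

(** [psid] has weight only on the two levels, where [Z] vanishes, so the variance is exactly
    [c * (1 - c) * g ^+ 2]. Hence [Delta = delta] whatever the value of [t]. *)
Lemma two_level_worst_case (R : realType) n (psid : 'cV[R[i]]_n.+2) delta t psi :
  braket psid psid = 1 -> 0 <= delta -> delta <= 1 / 2 ->
  1 / 2 < t -> t <= 1 -> orthonormal_basis psi ->
  mismatch psid (psi ord0) = mismatch_bound delta ->
  (forall k : 'I_n.+2, (2 <= k)%N -> braket (psi k) psid = 0) ->
  worst_case psid delta (mix_states (two_level t) psi) (two_level t) psi.
Proof.
move=> hpsid d0 d1 t0 t1 hpsi hm h2.
have l0 k : 0 <= two_level (n := n) t k.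
  by rewrite /two_level; case: ifP => _; [lra | case: ifP => _; lra].
have l1 : two_level t (ord_second n) = 1 - t by rewrite /two_level eqxx.
have es : eigensystem (mix_states (two_level t) psi) (two_level t) psi.
  split=> //.
  - move=> k; rewrite mix_states_mul (bigD1 k) //= hpsi eqxx scale1r.
    rewrite big1 ?addr0 // => l lk.
    by rewrite hpsi (negbTE lk) scale0r scaler0.
  - by rewrite l1 /two_level eqxx; lra.
  - move=> j k; rewrite /two_level.
    have [->|k0] := eqVneq k ord0; first by rewrite leqn0 => /eqP j0;
      rewrite (_ : j == ord0) // -val_eqE /= j0.
    have [_|j0] := eqVneq j ord0; first by move=> _ /=; case: ifP => _; lra.
    move=> jk; have [k1|k1] := eqVneq k (ord_second n); last by move=> /=; case: ifP => _; lra.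
    rewrite (_ : j == ord_second n) // -val_eqE /= eqn_leq lt0n.
    by move: jk j0; rewrite k1 -val_eqE /= => -> ->.
split=> //.
- apply: mix_states_density => //; rewrite big_ord_recl big_ord_recl /=.
  rewrite -/(ord_second n) l1 {1}/two_level eqxx big1 ?addr0; first by lra.
  by move=> k _; rewrite /two_level -!val_eqE.
- have g0 := eigen_gap_gt0 es; rewrite (DeltaE _ es).
  have [] := sigma_sqr hpsid es.
  have pZ k : Normc.normc (braket (psi k) psid) ^+ 2 *
      ((k != ord0)%:R * (two_level t (ord_second n) - two_level t k)) = 0.
    have [->|k0] := eqVneq k ord0; first by rewrite mul0r mulr0.
    have [->|k1] := eqVneq k (ord_second n); first by rewrite subrr !mulr0.
    rewrite h2 ?Normc.normc0 ?expr0n ?mul0r //.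
    by case: k k0 k1 => [[|[|k]]] //= ?; rewrite -!val_eqE.
  set z := \sum_k _; have -> : z = 0 by apply: big1 => k _; exact: pZ.
  rewrite mulr0 add0r big1 => [|k _]; last first.
    by rewrite subr0 expr2 mulrA pZ mul0r.
  rewrite addr0 hm mismatch_bound_root; last by nra.
  rewrite -exprMn => hs _.
  (* Both sides are nonnegative, so equality of squares suffices. *)
  have -> : sigma psid (mix_states (two_level t) psi) =
      delta * (two_level (n := n) t ord0 - two_level t (ord_second n)).
    apply/eqP; rewrite -(@eqrXn2 _ 2) ?hs ?sqrtr_ge0 //.
    by rewrite mulr_ge0 // ltW.
  by rewrite mulfK // gt_eqF.
Qed.

(** A single tilted basis fixes the mismatch, and varying the dominant eigenvalue [t] alone yields
    the family of states. *)
Lemma worst_cases_infinite (R : realType) n (psid : 'cV[R[i]]_n.+2) (delta : R) :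
  braket psid psid = 1 -> 0 <= delta -> delta <= 1 / 2 ->
  infinite_set [set rho : 'M[R[i]]_n.+2 |
                  exists lam psi, worst_case psid delta rho lam psi].
Proof.
move=> hpsid d0 d1.
have b01 : 0 <= mismatch_bound delta <= 1.
  by have /andP[-> h] := mismatch_bound_itv delta; lra.
have [psi [hpsi hm h2]] := exists_tilted_basis hpsid b01.
(* The shift by 3 keeps [t 0 = 2 / 3] strictly above [1 / 2]; a shift by 2 would close the gap at
   [m = 0]. *)
pose t (m : nat) : R := 1 - m.+3%:R^-1.
have t0 m : 1 / 2 < t m.
  have : m.+3%:R^-1 < (2 : R)^-1 by rewrite ltf_pV2 ?posrE // ltr_nat.
  by rewrite /t; move: (m.+3%:R^-1) => e; lra.
have t1 m : t m <= 1 by rewrite /t gerBl invr_ge0.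
pose rho m := mix_states (two_level (t m)) psi.
(* The eigenvalue on the common eigenvector [psi ord0] recovers [t m], hence [m]. *)
have rho_inj : injective rho.
  move=> m m' e; have w m0 : rho m0 *m psi ord0 = (t m0)%:C%C *: psi ord0.
    have [_ [_ + _ _ _] _ _] :=
      two_level_worst_case hpsid d0 d1 (t0 m0) (t1 m0) hpsi hm h2.
    by move=> ->; rewrite /two_level eqxx.
  have := congr1 (braket (psi ord0)) (w m); rewrite e w !braketZr hpsi !mulr1.
  by move=> /complexI /addrI /oppr_inj /invr_inj /eqP; rewrite eqr_nat => /eqP [].
apply: (@sub_infinite_set _ (range rho)); last first.
  by rewrite (eq_finite_set (inj_card_eq (in2W rho_inj))); exact: infinite_nat.
move=> _ [m _ <-]; exists (two_level (t m)), psi.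
exact: two_level_worst_case.
Qed.

Local Close Scope sesquilinear_scope.
Local Open Scope complex_scope.

Theorem theorem2 (R : realType) (n : nat) (psid : 'cV[R[i]]_n.+2)
    (hpsid : braket psid psid = 1) :
  [/\ (* the upper bound *)
      forall (rho : 'M[R[i]]_n.+2) (lam : 'I_n.+2 -> R)
             (psi : 'I_n.+2 -> 'cV[R[i]]_n.+2),
        density_matrix rho -> eigensystem rho lam psi ->
        Delta psid rho lam <= 1 / 2 ->
        mismatch psid (psi ord0) <= 1 / 2 ->
        mismatch psid (psi ord0) <= mismatch_bound (Delta psid rho lam),
      (* its expansion as Delta tends to 0 *)
      (fun x : R => mismatch_bound x) =
        (fun x : R => x ^+ 2 + x ^+ 4) +O_ (nbhs (0 : R)) (fun x : R => x ^+ 6),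
      (* infinitely many worst-case states for each fixed Delta *)
      forall delta : R, 0 <= delta -> delta <= 1 / 2 ->
        infinite_set [set rho : 'M[R[i]]_n.+2 |
                        exists lam psi, worst_case psid delta rho lam psi]
    & (* the eigenvectors of the worst-case states *)
      forall (delta : R) (rho : 'M[R[i]]_n.+2) (lam : 'I_n.+2 -> R)
             (psi : 'I_n.+2 -> 'cV[R[i]]_n.+2),
        delta <= 1 / 2 -> worst_case psid delta rho lam psi ->
        (forall k, lam k < lam (ord_second n) -> braket (psi k) psid = 0) /\
        (exists psi' : 'I_n.+2 -> 'cV[R[i]]_n.+2,
           [/\ eigensystem rho lam psi', psi' ord0 = psi ord0,
               forall k : 'I_n.+2, (2 <= k)%N -> braket (psi' k) psid = 0,
               braket (psi' ord0) psid != 0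
             & 0 < delta -> braket (psi' (ord_second n)) psid != 0])].
Proof.
split.
- by move=> rho lam psi _ hes _; exact: mismatch_upper_bound hpsid hes.
- exact: mismatch_bound_expansion.
- by move=> delta; exact: worst_cases_infinite hpsid.
- move=> delta rho lam psi hd hw; split; last exact: worst_case_eigenvectors hw.
  move=> k kl; have [_ [_ _ h12 _ _] _ _] := hw.
  apply: (worst_case_support hpsid hd hw); last by rewrite lt_eqF.
  (* An eigenvalue below [lam_2] cannot be the dominant one, which exceeds [lam_2]. *)
  by apply/eqP => k0; move: kl; rewrite k0 ltNge ltW.
Qed.
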